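(* Let $p$ be an odd prime, $k\ge2$ and $s=k+2$. Put $S=\sum_{j=0}^{k-1}p^j$ and $C=2(k+1)p^{k+1}-1$. For $0\le l<p^k$, the $p^k$-Fibonacci number of $V_{s,l}$ is as follows. (a) If $l=0$: $\mathcal M_{V_{s,l}}=\frac{p-1}{2}\,C$. (b) If $0\le i\le k-2$, $1\le t\le p-1$ and $(t-1)\sum_{\iota=i}^{k-1}p^\iota+p^i\le l\le (t-1)\sum_{\iota=i+1}^{k-1}p^\iota+p^{i+1}-1$: $\mathcal M_{V_{s,l}}=\frac{p-1}{2}\big(C+2tS-2\sum_{\mu=0}^{k-i-2}p^\mu\big)$ if $1\le t\le\frac{p-1}{2}$, and $\mathcal M_{V_{s,l}}=\frac{p-1}{2}\big(C+(2t-2p)S-2\sum_{\mu=0}^{k-i-2}p^\mu\big)$ if $\frac{p+1}{2}\le t\le p-1$. (c) If $1\le t\le p-1$, $t\neq\frac{p-1}{2}$, and $tp^{k-1}\le l\le tS$: $\mathcal M_{V_{s,l}}=\frac{p-1}{2}(C+2tS)$ if $1\le t\le\frac{p-3}{2}$, and $\mathcal M_{V_{s,l}}=\frac{p-1}{2}(C+(2t-2p)S)$ if $\frac{p+1}{2}\le t\le p-1$. (d) If $1\le i'\le k-1$ and $\frac{p-1}{2}\sum_{\iota=i'}^{k-1}p^\iota\le l\le\frac{p-1}{2}\sum_{\iota=i'-1}^{k-1}p^\iota-1$: $\mathcal M_{V_{s,l}}=\frac{p-1}{2}\Big(C-p^k-2\sum_{\theta=1}^{k-1}p^\theta+2\sum_{\mu=k-i'+1}^{k}p^\mu-1\Big)$.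 (e) If $l=\frac{p-1}{2}S$: $\mathcal M_{V_{s,l}}=\frac{p-1}{2}\Big(C-p^k-2\sum_{\theta=1}^{k-1}p^\theta-1\Big)$.
   Context: Fix an odd prime $p$ and an integer $k\ge 0$. For integers $0\le i<n$ write $\lambda(n,i)=(n-i,1^i)$ for the hook partition of $n$ with $n-i$ boxes in its first row and $i$ further boxes in its first column. If $\mu=\lambda(n',i')$ is obtained from $\lambda(n,i)$ by appending $m=(n'-i')-(n-i)\ge 0$ boxes to the first row and $n''=i'-i\ge 0$ boxes to the first column, we say $\mu$ is obtained by adding the block $B_{m,n''}$ ($m$ horizontal nodes, $n''$ vertical nodes). Put $x_s=p^k(sp-(s+1))$. The relevant part (''column $k$'') of the $p$-Bratteli diagram is the graded directed graph with vertices: on floor $2k+1$, $S_i=\lambda(p^k(p-1),i)$ for $0\le i<p^k(p-1)$; on floor $2(k+s)$ ($s\ge1$), $V_{s,l}=\lambda\big(p^k(2sp-(2s+1)),\,x_s+l\big)$ for $0\le l<p^k$; on floor $2(k+s)-1$ ($s\ge2$), $W_{s,l'}=\lambda\big(p^k((2s-1)p-2s),\,x_{s-1}+l'\big)$ for $0\le l'<p^{k+1}$; and edges, each labelled by the block added: (E1) $S_i\to V_{1,l}$ exactly when $i=p^kt+l$ with $0\le t\le p-2$, block $B_{p^kt,\,p^k(p-2-t)}$; (E2) for $s\ge2$, $0\le l<p^k$, $0\le\beta\le p-1$: $V_{s-1,l}\to W_{s,pl+\beta}$, block $B_{p^k(p-1)-((p-1)l+\beta),\,(p-1)l+\beta}$;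 (E3) for $s\ge 2$, $0\le l'<p^{k+1}$ and $t=\lfloor l'/p^k\rfloor$: $W_{s,l'}\to V_{s,l'-p^kt}$, block $B_{p^kt,\,p^k(p-1-t)}$. A path ending at a vertex $v$ is a sequence of edges starting at some $S_i$ and going up one floor at a time to $v$ ($S_i\to V_{1,\cdot}\to W_{2,\cdot}\to V_{2,\cdot}\to W_{3,\cdot}\to\cdots\to v$); $\mathcal P(v)$ is the set of all paths ending at $v$. The blocks of a path are numbered $B^2,B^3,\dots,B^N$: $B^2$ is the block of the edge leaving $S_i$, and for $j\ge2$, $B^{2j-1}$ is the block of the edge into $W_{j,\cdot}$ and $B^{2j}$ the block of the edge into $V_{j,\cdot}$. Write $B^j=B_{m_j,n_j}$. Descents: $1\in\mathrm{Des}(P)$ iff $m_2=p^kt$ with $0\le t<\frac{p-1}{2}$; $2\notin\mathrm{Des}(P)$; for $3\le j<N$, $j\in\mathrm{Des}(P)$ iff $m_j>m_{j+1}$ and $n_j<n_{j+1}$. $\mathrm{des}(P)=|\mathrm{Des}(P)|$. The $p^k$-Fibonacci number of a vertex $v$ is $\mathcal M_v=\sum_{P\in\mathcal P(v)}\mathrm{des}(P)$. *)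

(* Defs.v *)
From HB Require Import structures.
From mathcomp Require Import all_boot all_order all_algebra.
Set Implicit Arguments. Unset Strict Implicit. Unset Printing Implicit Defensive.
Import Order.TTheory GRing.Theory Num.Theory.

(* Vertices of column k of the p-Bratteli diagram:
   S_ i   = S_i     = lambda(p^k(p-1), i)                 (floor 2k+1)
   V_ s l = V_{s,l} = lambda(p^k(2sp-(2s+1)), x_s + l)     (floor 2(k+s))
   W_ s l'= W_{s,l'}= lambda(p^k((2s-1)p-2s), x_{s-1}+l')  (floor 2(k+s)-1) *)
Inductive vtx := S_ of nat | V_ of nat & nat | W_ of nat & nat.

Definition vtx_code (v : vtx) : nat * nat * nat :=
  match v with S_ i => (0, 0, i) | V_ s l => (1, s, l) | W_ s l => (2, s, l) end.
Definition vtx_decode (c : nat * nat * nat) : vtx :=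
  match c with
  | (0, _, i) => S_ i | (1, s, l) => V_ s l | (_, s, l) => W_ s l end.
Lemma vtx_codeK : cancel vtx_code vtx_decode. Proof. by case. Qed.
HB.instance Definition _ := Equality.copy vtx (can_type vtx_codeK).

(* The labelled edges (E1), (E2), (E3): [edge p k u v = Some (m, n)] iff there is
   an edge u -> v, labelled by the block B_{m,n}. *)
Definition edge (p k : nat) (u v : vtx) : option (nat * nat) :=
  match u, v with
  | S_ i, V_ s l =>
      let t := i %/ p ^ k in
      if [&& i < p ^ k * (p - 1), s == 1, l < p ^ k, t <= p - 2
           & i == p ^ k * t + l]
      then Some (p ^ k * t, p ^ k * (p - 2 - t)) else None
  | V_ s l, W_ s' l' =>
      let beta := l' - p * l in
      if [&& 2 <= s', s == s' - 1, l < p ^ k, l' < p ^ k.+1, p * l <= l'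
           & beta <= p - 1]
      then Some (p ^ k * (p - 1) - ((p - 1) * l + beta), (p - 1) * l + beta)
      else None
  | W_ s l', V_ s' l =>
      let t := l' %/ p ^ k in
      if [&& 2 <= s, s' == s, l' < p ^ k.+1 & l == l' - p ^ k * t]
      then Some (p ^ k * t, p ^ k * (p - 1 - t)) else None
  | _, _ => None
  end.

(* The vertex with label x at position j of a path (position 0 = floor 2k+1):
   floor 2k+1 only contains the S_i, floor 2(k+s) the V_{s,.}, floor
   2(k+s)-1 (s >= 2) the W_{s,.}. *)
Definition col_vtx (j x : nat) : vtx :=
  if j == 0 then S_ x else if odd j then V_ j.+1./2 x else W_ j./2.+1 x.

(* Number of vertices of a path ending at v (floor(v) - 2k). *)
Definition npos (v : vtx) : nat :=
  match v with S_ _ => 1 | V_ s _ => s.*2 | W_ s _ => s.*2.-1 end.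

(* A candidate path is a sequence of labels (all labels of the column are
   < p^(k+1)); f j is the label of the j-th vertex. *)
Section Paths.
Variables (p k : nat).

Definition lab (n : nat) (x : n.-tuple 'I_(p ^ k.+1)) (j : nat) : nat :=
  nth 0 (map val x) j.

Definition vert (n : nat) (x : n.-tuple 'I_(p ^ k.+1)) (j : nat) : vtx :=
  col_vtx j (lab x j).

Definition is_path_to (v : vtx) (x : (npos v).-tuple 'I_(p ^ k.+1)) : bool :=
  [&& all (fun j => edge p k (vert x j) (vert x j.+1) != None)
          (iota 0 (npos v).-1)
    & vert x (npos v).-1 == v].

(* the blocks B^2, ..., B^N of the path *)
Definition blocks (n : nat) (x : n.-tuple 'I_(p ^ k.+1)) : seq (nat * nat) :=
  [seq odflt (0, 0) (edge p k (vert x j) (vert x j.+1)) | j <- iota 0 n.-1].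

Definition Bl (bs : seq (nat * nat)) (j : nat) : nat * nat := nth (0, 0) bs (j - 2).

(* des(P) for the block sequence bs = [B^2; ...; B^N] *)
Definition des_blocks (bs : seq (nat * nat)) : nat :=
  let N := (size bs).+1 in
  [exists t : 'I_((p - 1)./2), (Bl bs 2).1 == p ^ k * t]
  + \sum_(3 <= j < N)
      (((Bl bs j.+1).1 < (Bl bs j).1) && ((Bl bs j).2 < (Bl bs j.+1).2)).

Definition pkFib (v : vtx) : nat :=
  \sum_(x : (npos v).-tuple 'I_(p ^ k.+1) | is_path_to x) des_blocks (blocks x).

End Paths.

(* Main.v *)
Require Import Defs.
From HB Require Import structures.
From mathcomp Require Import all_boot all_order all_algebra.
From mathcomp Require Import zify ring.
Import Order.TTheory GRing.Theory Num.Theory.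

(* Along a path the label of V_{j,.} is shifted by one base-p digit at each step,
   so a path to V_{s,l} is a choice of t < p - 1 together with a word of
   k + s - 1 base-p digits ending in the k digits of l, and the labels of the W
   vertices are its windows of k + 1 digits.  Since w |-> w - w %/ p is
   nondecreasing and sends the repdigit c...c (k + 1 digits) to c p^k, the odd
   descents say that a window is smaller than h...h, h = (p - 1)/2, and the even
   ones that it is larger than the repdigit of p - 1 - a, where a is the digit
   preceding the window.  Counting words one window at a time, only the d leading
   digits of l seen by the window matter; for s = k + 2 the excess over h C is
     2 h sum_(1 <= d <= k) (p^(d-1) c_d - p^d [l_d >= h...h]),
   where l_d consists of the d leading digits of l and c_d is the number of d-digit
   repdigits b...b, b < p, that are smaller than l_d. *)

(** * Repunits, and the values of [w - w %/ p] at repdigits *)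

Definition repunit (p n : nat) : nat := \sum_(0 <= j < n) p ^ j.

Lemma repunitSr p n : repunit p n.+1 = repunit p n + p ^ n.
Proof. by rewrite /repunit big_nat_recr. Qed.

Lemma repunitS p n : repunit p n.+1 = p * repunit p n + 1.
Proof.
elim: n => [|n IHn]; first by rewrite /repunit big_nat1 big_geq // muln0.
by rewrite repunitSr {1}IHn [in RHS]repunitSr mulnDr expnS addnAC.
Qed.

Lemma expn_repunit p n : 0 < p -> p ^ n = (p - 1) * repunit p n + 1.
Proof.
move=> p_gt0; elim: n => [|n IHn]; first by rewrite /repunit big_geq // muln0.
rewrite expnS repunitSr; nia.
Qed.

Lemma repunitD p n d : repunit p (n + d) = repunit p n * p ^ d + repunit p d.
Proof.
elim: n => [|n IHn]; first by rewrite /repunit (big_geq (leqnn 0)).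
by rewrite addSn !repunitSr IHn expnD; nia.
Qed.

Lemma sum_pow_repunit p k e : e <= k ->
  \sum_(e <= j < k) p ^ j = repunit p (k - e) * p ^ e.
Proof.
move=> le_ek; apply: (@addnI (repunit p e)).
rewrite -big_cat_nat // addnC -repunitD subnK //.
Qed.

(** With [b = u * p + v] and [y = c * repunit p k], the two sides compare [(p - 1) * u + v] with
    [(p - 1) * y + c], and [p * u + v] with [p * y + c]. These comparisons can only disagree through
    the tie [v = p - 1], [u + 1 = y], [c = 0], which is impossible because [c = 0] forces
    [y = 0]. *)
Lemma lt_sub_div p k b c : 0 < p -> c < p ->
  (b - b %/ p < p ^ k * c) = (b < c * repunit p k.+1).
Proof.
move=> p_gt0 lt_cp.
have -> : p ^ k * c = (p - 1) * (c * repunit p k) + c.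
  by rewrite (expn_repunit _ _ p_gt0); nia.
rewrite repunitS mulnDr mulnCA muln1.
have y0 : c = 0 -> c * repunit p k = 0 by move=> ->.
move: (c * repunit p k) y0 => y y0.
have lt_v := ltn_pmod b p_gt0; have := divn_eq b p.
move: (b %/ p) (b %% p) lt_v => u v lt_v ->.
have -> : u * p + v - u = (p - 1) * u + v.
  by rewrite mulnBl mul1n mulnC addnBAC ?leq_pmull.
by case: (ltngtP u y) => [lt_uy|lt_yu|->]; case: (posnP c) => [c0|c_gt0]; nia.
Qed.

(** Here the dangerous tie is [u = y + 1], [v = 0], [c = p - 1]. It is excluded by the bound on [b],
    which gives [u <= p ^ k - 1], and this is the value of [y] when [c = p - 1]. *)
Lemma gt_sub_div p k b c : 0 < p -> c < p -> b < p ^ k.+1 ->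
  (p ^ k * c < b - b %/ p) = (c * repunit p k.+1 < b).
Proof.
move=> p_gt0 lt_cp; rewrite expnS (expn_repunit p k p_gt0).
have -> : ((p - 1) * repunit p k + 1) * c = (p - 1) * (c * repunit p k) + c.
  by rewrite mulnDl mul1n -mulnA [_ * c]mulnC.
have -> : c * repunit p k.+1 = p * (c * repunit p k) + c.
  by rewrite repunitS mulnDr mulnCA muln1.
have y0 : c = 0 -> c * repunit p k = 0 by move=> ->.
have y1 : c = p - 1 -> c * repunit p k = (p - 1) * repunit p k by move=> ->.
move: (c * repunit p k) ((p - 1) * repunit p k) y0 y1 => y z y0 y1.
have lt_v := ltn_pmod b p_gt0; have := divn_eq b p.
move: (b %/ p) (b %% p) lt_v => u v lt_v -> lt_b.
have le_uz : u <= z by nia.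
have -> : u * p + v - u = (p - 1) * u + v.
  by rewrite mulnBl mul1n mulnC addnBAC ?leq_pmull.
case: (ltngtP u y) => [lt_uy|lt_yu|->]; last by rewrite [y * p]mulnC !ltn_add2l.
  by case: (posnP c) => [c0|c_gt0]; nia.
have : c != p - 1 by apply/eqP => /y1; lia.
by nia.
Qed.

(** Let [t] be the leading digit of [b]. If [t < h], then [b] lies below the repdigits of both [h]
    and [p - 1 - t]; if [t > h], it lies below neither; if [t = h], the two repdigits coincide.
    Hence the threshold may be taken independent of [b]. *)
Lemma half_threshold p h k b : p = h.*2.+1 -> b < p ^ k.+1 ->
  (b - b %/ p < p ^ k * (p - 1 - b %/ p ^ k)) = (b < h * repunit p k.+1).
Proof.
move=> p_h lt_b; have p_gt0 : 0 < p by rewrite p_h.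
rewrite lt_sub_div //; last by rewrite -subnDA ltn_subrL p_gt0.
have q_gt0 : 0 < p ^ k by rewrite expn_gt0 p_gt0.
have := leq_divM b (p ^ k); have := ltn_ceil b q_gt0.
have : b %/ p ^ k < p by rewrite ltn_divLR // mulnC -expnSr.
have := repunitSr p k; have := expn_repunit p k p_gt0.
move: (b %/ p ^ k) => t; move: (p ^ k) q_gt0 (repunit p k.+1) (repunit p k).
move=> q q_gt0 r r0 q_eq r_eq lt_t b_up b_lo; case: (ltngtP t h) => [lt_th|lt_ht|->].
- have -> : b < h * r by nia.
  have le_r : h * r <= (p - 1 - t) * r by rewrite leq_mul2r; lia.
  by apply: (leq_trans _ le_r); nia.
- have : (p - 1 - t) * r <= h * r by rewrite leq_mul2r; lia.
  have : h * r < h.+1 * q by nia.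
  have : h.+1 * q <= b by nia.
  by lia.
- by have -> : p - 1 - h = h by lia.
Qed.

Lemma sum_divn_modn a b (F : nat -> nat -> nat) : 0 < b ->
  \sum_(0 <= i < a * b) F (i %/ b) (i %% b) =
  \sum_(0 <= x < a) \sum_(0 <= y < b) F x y.
Proof.
move=> b_gt0; elim: a => [|a IHa]; first by rewrite mul0n !big_geq.
rewrite big_nat_recr //= -IHa mulSnr (@big_cat_nat _ _ _ (a * b)) ?leq_addr //=.
congr (_ + _); rewrite -{1}[a * b]add0n big_addn addKn.
apply: eq_big_nat => y lt_yb; rewrite addnC divnMDl // modnMDl.
by rewrite divn_small ?modn_small ?addn0; lia.
Qed.

(** * Edges and paths in terms of labels *)

Lemma edge_SV p k a b : 0 < p ->
  edge p k (S_ a) (V_ 1 b) =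
  if (a < p ^ k * (p - 1)) && (b == a %% p ^ k)
  then Some (p ^ k * (a %/ p ^ k), p ^ k * (p - 2 - a %/ p ^ k)) else None.
Proof.
move=> p_gt0 /=; have q_gt0 : 0 < p ^ k by rewrite expn_gt0 p_gt0.
case: ltnP => //= lt_a.
have -> : a %/ p ^ k <= p - 2.
  have : a %/ p ^ k < p - 1 by rewrite ltn_divLR // mulnC.
  by lia.
have -> : (a == p ^ k * (a %/ p ^ k) + b) = (b == a %% p ^ k).
  by rewrite {1}(divn_eq a (p ^ k)) mulnC eqn_add2l eq_sym.
by case: eqP => [->|_]; rewrite ?ltn_pmod ?q_gt0 ?andbF.
Qed.

(** The source label is the target label without its last digit, so the target determines both the
    edge and its block: [(p - 1) * a + (b - p * a) = b - a] with [a = b %/ p]. *)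
Lemma edge_VW p k i a b : 0 < p ->
  edge p k (V_ i.+1 a) (W_ i.+2 b) =
  if (b < p ^ k.+1) && (a == b %/ p)
  then Some (p ^ k * (p - 1) - (b - b %/ p), b - b %/ p) else None.
Proof.
move=> p_gt0 /=; rewrite subn1 eqxx /=.
case: (ltnP b) => lt_b; last by rewrite andbF.
have -> : [&& a < p ^ k, true, p * a <= b & b - p * a <= p - 1] = (a == b %/ p).
  apply/and4P/eqP => [[_ _ le_ab le_beta]|->].
    have -> : b = a * p + (b - p * a) by rewrite [a * p]mulnC subnKC.
    by rewrite divnMDl // divn_small ?addn0 //; lia.
  have e := divn_eq b p; have lt_v := ltn_pmod b p_gt0.
  split=> //; first by rewrite ltn_divLR // -expnSr.
    by rewrite mulnC leq_divM.
  by rewrite {1}e mulnC addKn; lia.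
case: eqP => // ->; congr (Some (_ - _, _)).
  by rewrite mulnBl mul1n addnBAC ?leq_pmull // subnKC // mulnC leq_divM.
by rewrite mulnBl mul1n addnBAC ?leq_pmull // subnKC // mulnC leq_divM.
Qed.

Lemma edge_WV p k i b c :
  edge p k (W_ i.+2 b) (V_ i.+2 c) =
  if (b < p ^ k.+1) && (c == b %% p ^ k)
  then Some (p ^ k * (b %/ p ^ k), p ^ k * (p - 1 - b %/ p ^ k)) else None.
Proof.
rewrite /= eqxx /=; congr (if _ && (_ == _) then _ else _).
by rewrite {1}(divn_eq b (p ^ k)) mulnC addKn.
Qed.

Lemma col_vtx_V i x : col_vtx i.*2.+1 x = V_ i.+1 x.
Proof. by rewrite /col_vtx /= odd_double /= doubleK. Qed.

Lemma col_vtx_W i x : col_vtx i.*2.+2 x = W_ i.+2 x.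
Proof. by rewrite /col_vtx /= odd_double /= doubleK. Qed.

(* [f j] is the label at position [j] of a path ending at V_{s+1,l}. *)
Definition path_labels (p k s l : nat) (f : nat -> nat) : Prop :=
  [/\ f 0 < p ^ k * (p - 1), f 1 = f 0 %% p ^ k,
      forall i, i < s -> f i.*2.+1 = f i.*2.+2 %/ p /\ f i.*2.+3 = f i.*2.+2 %% p ^ k
    & f s.*2.+1 = l].

Lemma lab_lt p k n (x : n.-tuple 'I_(p ^ k.+1)) j : 0 < p -> lab x j < p ^ k.+1.
Proof.
move=> p_gt0; rewrite /lab; case: (ltnP j n) => [lt_jn|le_nj].
  by rewrite (nth_map (tnth x (Ordinal lt_jn))) ?size_tuple ?ltn_ord.
by rewrite nth_default ?size_map ?size_tuple // expn_gt0 p_gt0.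
Qed.

Lemma is_path_toP p k s l (x : (npos (V_ s.+1 l)).-tuple 'I_(p ^ k.+1)) : 0 < p ->
  reflect (path_labels p k s l (lab x)) (is_path_to x).
Proof.
move=> p_gt0; rewrite /is_path_to -[(npos _).-1]/(s.*2.+1).
apply: (iffP andP) => [[/allP path_x /eqP]|[f0 f1 fS fl]].
  rewrite /vert col_vtx_V => -[fl].
  have {}path_x j : j < s.*2.+1 -> edge p k (vert x j) (vert x j.+1) != None.
    by move=> lt_j; apply: path_x; rewrite mem_iota.
  have := path_x 0 isT; rewrite /vert (col_vtx_V 0) edge_SV //.
  case: ifP => // /andP[f0 /eqP f1] _; split=> // i lt_is; split.
  have /path_x : i.*2.+1 < s.*2.+1 by lia.
  rewrite /vert col_vtx_V col_vtx_W edge_VW //.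
    by rewrite lab_lt //=; case: ifP => [/eqP|].
  have /path_x : i.*2.+2 < s.*2.+1 by lia.
  rewrite /vert -doubleS col_vtx_V col_vtx_W edge_WV //.
  by rewrite lab_lt //=; case: ifP => [/eqP|].
split; last by rewrite /vert col_vtx_V fl.
apply/allP => j; rewrite mem_iota /= add0n => lt_j; rewrite /vert.
case: j lt_j => [_|j]; first by rewrite (col_vtx_V 0) edge_SV // f0 f1 eqxx.
rewrite -[j]odd_double_half; case: odd => /=; rewrite ?add1n ?add0n => lt_j.
  rewrite -doubleS col_vtx_V col_vtx_W edge_WV // lab_lt //.
  by have [|_ ->] := fS j./2; [lia | rewrite eqxx].
rewrite col_vtx_V col_vtx_W edge_VW // lab_lt //.
by have [|-> _] := fS j./2; [lia | rewrite eqxx].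
Qed.

(** * Descents of a path in terms of labels *)

Lemma sum_odd_even s (F : nat -> nat) :
  \sum_(3 <= j < s.+1.*2) F j =
  \sum_(0 <= i < s) F i.*2.+3 + \sum_(0 <= i < s.-1) F i.+1.*2.+2.
Proof.
case: s => [|s]; first by rewrite !big_geq.
elim: s => [|s IHs]; first by rewrite !big_nat1 big_geq ?addn0.
rewrite doubleS 2?big_nat_recr //=; try lia.
rewrite IHs [in RHS]big_nat_recr //= [X in _ = _ + X]big_nat_recr //=.
by rewrite !doubleS; lia.
Qed.

(** From [B^3] on, the two entries of every block add up to [p ^ k * (p - 1)], so the two
    inequalities defining a descent are equivalent and only one has to be read. At odd positions it
    compares two quantities attached to the same W vertex; at even positions it compares the leading
    digit of one W label with the next W label. *)
Lemma des_path p h k s l (x : (npos (V_ s.+1 l)).-tuple 'I_(p ^ k.+1)) :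
  p = h.*2.+1 -> 0 < h -> is_path_to x ->
  des_blocks p k (blocks x) =
  (lab x 0 %/ p ^ k < h)
  + \sum_(0 <= i < s) (lab x i.*2.+2 < h * repunit p k.+1)
  + \sum_(0 <= i < s.-1)
      ((p - 1 - lab x i.*2.+2 %/ p ^ k) * repunit p k.+1 < lab x i.*2.+4).
Proof.
move=> p_h h_gt0 path_x; have p_gt0 : 0 < p by rewrite p_h.
have q_gt0 : 0 < p ^ k by rewrite expn_gt0 p_gt0.
have [f0 f1 fS fl] := elimT (is_path_toP _ _ _ _ x p_gt0) path_x.
have BlE j : 2 <= j < s.*2.+3 ->
    Bl (blocks x) j = odflt (0, 0) (edge p k (vert x (j - 2)) (vert x (j - 2).+1)).
  move=> lt_j; rewrite /Bl /blocks -[(npos _).-1]/(s.*2.+1).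
  by rewrite (nth_map 0) ?size_iota ?nth_iota ?add0n //; lia.
have Bodd i : i < s -> Bl (blocks x) i.*2.+3 =
    (p ^ k * (p - 1) - (lab x i.*2.+2 - lab x i.*2.+2 %/ p),
     lab x i.*2.+2 - lab x i.*2.+2 %/ p).
  move=> lt_i; rewrite BlE; last by lia.
  rewrite subn2 /= /vert col_vtx_V col_vtx_W edge_VW // lab_lt //.
  by have [-> _] := fS i lt_i; rewrite eqxx.
have Beven i : i < s -> Bl (blocks x) i.*2.+4 =
    (p ^ k * (lab x i.*2.+2 %/ p ^ k), p ^ k * (p - 1 - lab x i.*2.+2 %/ p ^ k)).
  move=> lt_i; rewrite BlE; last by lia.
  rewrite subn2 /= /vert -doubleS col_vtx_V col_vtx_W edge_WV // lab_lt //.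
  by have [_ ->] := fS i lt_i; rewrite eqxx.
(* The case [c = p - 1], whose repdigit is [p ^ k.+1 - 1]. It makes the truncated subtraction in the
   blocks into W exact. *)
have f_le b : b < p ^ k.+1 -> b - b %/ p <= p ^ k * (p - 1).
  move=> lt_b; rewrite leqNgt gt_sub_div ?subn1 ?ltn_predL // -leqNgt.
  by have := expn_repunit p k.+1 p_gt0; rewrite subn1; lia.
have f_lt j : lab x j %/ p ^ k < p.
  by rewrite ltn_divLR // -expnS lab_lt.
rewrite /des_blocks size_map size_iota /= -doubleS sum_odd_even addnA.
congr (_ + _ + _).
- rewrite BlE // /vert (col_vtx_V 0) edge_SV // f0 f1 eqxx /=; congr nat_of_bool.
  have -> : (p - 1)./2 = h by rewrite p_h subn1 /= doubleK.
  apply/existsP/idP => [[t]|lt_h]; first by rewrite eqn_pmul2l // => /eqP ->.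
  by exists (Ordinal lt_h).
- apply: eq_big_nat => i /= lt_i; rewrite Bodd // Beven //=.
  rewrite -(half_threshold _ _ _ _ p_h) ?lab_lt //; congr nat_of_bool.
  have := f_le _ (lab_lt _ _ _ x i.*2.+2 p_gt0); have := f_lt i.*2.+2.
  by move: (lab x i.*2.+2 %/ p ^ k) (_ - _) => t n; nia.
- apply: eq_big_nat => i /= lt_i; rewrite [Bl _ _.+1](Bodd i.+1); last by lia.
  rewrite [Bl _ _]Beven; last by lia.
  rewrite -gt_sub_div ?lab_lt //=; last by rewrite -subnDA ltn_subrL p_gt0.
  congr nat_of_bool.
  have := f_le _ (lab_lt _ _ _ x i.*2.+4 p_gt0); have := f_lt i.*2.+2.
  rewrite -[i.+1.*2.+2]/(i.*2.+4) [_ * (p - 1 - _)]mulnBr.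
  move: (lab x i.*2.+2 %/ p ^ k) => t lt_t.
  move: (lab x i.*2.+4 - _) => n le_n.
  have : p ^ k * t <= p ^ k * (p - 1) by rewrite leq_mul2l; lia.
  by move: (p ^ k * t) (p ^ k * (p - 1)) le_n => y z; lia.
Qed.

(** * The bijection between paths and words *)

(** Each label is a window of the word [U] of [k + s] digits: [k] digits at odd positions (V),
    [k + 1] digits at even positions (W), sliding by one digit per floor of V. Position 0 carries
    the [k] leading digits of [U] preceded by the extra digit [t]. *)
Definition word_lab (p k s t U j : nat) : nat :=
  if j is 0 then p ^ k * t + U %/ p ^ s
  else (U %/ p ^ (s - j./2)) %% p ^ (k + ~~ odd j).

Lemma word_lab_V p k s t U i :
  word_lab p k s t U i.*2.+1 = (U %/ p ^ (s - i)) %% p ^ k.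
Proof. by rewrite /word_lab /= odd_double /= addn0 uphalf_double. Qed.

Lemma word_lab_W p k s t U i :
  word_lab p k s t U i.*2.+2 = (U %/ p ^ (s - i.+1)) %% p ^ k.+1.
Proof. by rewrite /word_lab /= odd_double /= addn1 doubleK. Qed.

Lemma word_lab_path p k s t U : 0 < p -> t < p - 1 -> U < p ^ (k + s) ->
  path_labels p k s (U %% p ^ k) (word_lab p k s t U).
Proof.
move=> p_gt0 lt_t lt_U; have q_gt0 n : 0 < p ^ n by rewrite expn_gt0 p_gt0.
have lt_Us : U %/ p ^ s < p ^ k by rewrite ltn_divLR // -expnD.
split.
- by rewrite /word_lab; nia.
- by rewrite (word_lab_V p k s t U 0) subn0 /word_lab mulnC modnMDl.
- move=> i lt_is; rewrite -doubleS !word_lab_V word_lab_W.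
  have -> : s - i = (s - i.+1).+1 by lia.
  rewrite expnSr divnMA; split; first by rewrite modn_divl -expnSr.
  by rewrite modn_dvdm // expnS dvdn_mull.
- by rewrite word_lab_V subnn divn1.
Qed.

(* The base-p word encoded by a path: each step V -> W appends one digit. *)
Fixpoint word_of (p : nat) (f : nat -> nat) (i : nat) : nat :=
  if i is i'.+1 then p * word_of p f i' + f i'.*2.+2 %% p else f 1.

(** The word is recovered from the labels; this yields the injectivity of the encoding. *)
Lemma word_of_lab p k s t U f i : 0 < p -> U < p ^ (k + s) -> i <= s ->
  (forall j, j < s.*2.+2 -> f j = word_lab p k s t U j) ->
  word_of p f i = U %/ p ^ (s - i).
Proof.
move=> p_gt0 lt_U + fE; have q_gt0 n : 0 < p ^ n by rewrite expn_gt0 p_gt0.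
elim: i => [|i IHi] le_is /=.
  by rewrite fE // (word_lab_V p k s t U 0) subn0 modn_small // ltn_divLR // -expnD.
rewrite IHi ?(ltnW le_is) // fE; last by lia.
rewrite word_lab_W modn_dvdm ?expnS ?dvdn_mulr //.
have -> : s - i = (s - i.+1).+1 by lia.
by rewrite expnSr divnMA mulnC -divn_eq.
Qed.

(** Surjectivity of the encoding: consecutive labels overlap in [k] digits, so appending the last
    digit of each W label assembles a word whose windows are exactly the labels. *)
Lemma word_of_path p k s l f : 0 < p -> path_labels p k s l f ->
  (forall j, f j < p ^ k.+1) ->
  [/\ word_of p f s < p ^ (k + s), word_of p f s %% p ^ k = l
    & forall j, j < s.*2.+2 ->
      f j = word_lab p k s (f 0 %/ p ^ k) (word_of p f s) j].
Proof.
move=> p_gt0 [f0 f1 fS fl] lt_f.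
have q_gt0 n : 0 < p ^ n by rewrite expn_gt0 p_gt0.
(* The V label is the W label without its last digit, so appending that digit rebuilds the W
   label. *)
have wordW i : i < s -> word_of p f i %% p ^ k = f i.*2.+1 ->
    word_of p f i.+1 %% p ^ k.+1 = f i.*2.+2.
  move=> lt_is wV; have [fV _] := fS i lt_is.
  rewrite /= mulnC {1}(divn_eq (word_of p f i) (p ^ k)) mulnDl -mulnA -expnSr.
  by rewrite -addnA modnMDl wV fV -divn_eq modn_small.
have wordV i : i <= s -> word_of p f i %% p ^ k = f i.*2.+1
                         /\ word_of p f i < p ^ (k + i).
  elim: i => [|i IHi] le_is; first by rewrite /= addn0 f1 modn_mod ltn_pmod.
  have [wV lt_w] := IHi (ltnW le_is); split.
    have [_ fW] := fS i le_is.
    by rewrite doubleS fW -(wordW i le_is wV) modn_dvdm // expnS dvdn_mull.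
  rewrite /= addnS expnS; have := ltn_pmod (f i.*2.+2) p_gt0.
  by move: (_ %% _) => v; nia.
have [word_mod word_lt] := wordV s (leqnn s).
have word_div i : i <= s -> word_of p f s %/ p ^ (s - i) = word_of p f i.
  move=> le_is; rewrite -{1}(subnKC le_is); move: (s - i) => n.
  elim: n => [|n IHn]; first by rewrite addn0 divn1.
  rewrite addnS /= expnS divnMA [p * _]mulnC divnMDl //.
  by rewrite [_ %% _ %/ _]divn_small ?ltn_pmod // addn0.
split=> //; first by rewrite word_mod.
case=> [_|j].
  have /= := word_div 0 isT; rewrite subn0 /word_lab f1 => ->.
  by rewrite mulnC -divn_eq.
rewrite -[j]odd_double_half; case: odd; rewrite ?add1n ?add0n => lt_j.
  have lt_js : j./2 < s by lia.
  by rewrite word_lab_W word_div // wordW // (wordV _ (ltnW lt_js)).1.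
have le_js : j./2 <= s by lia.
by rewrite word_lab_V word_div // (wordV _ le_js).1.
Qed.

Lemma eq_path_labels p k s l l' f g : (forall j, j < s.*2.+2 -> f j = g j) -> l = l' ->
  path_labels p k s l f -> path_labels p k s l' g.
Proof.
move=> eq_fg <- [f0 f1 fS fl]; split; rewrite -?eq_fg //.
by move=> i lt_is; rewrite -!eq_fg; [exact: fS | lia..].
Qed.

Lemma lab_tnth p k n (x : n.-tuple 'I_(p ^ k.+1)) (j : 'I_n) : lab x j = tnth x j.
Proof. by rewrite /lab (nth_map (tnth x j)) ?size_tuple // -tnth_nth. Qed.

(* The reduction mod p^(k+1) only makes the labels typecheck, see lab_word_tuple. *)
Definition word_tuple (p k : nat) (q_gt0 : 0 < p ^ k.+1) (s t U : nat) :
    s.+1.*2.-tuple 'I_(p ^ k.+1) :=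
  [tuple Ordinal (ltn_pmod (word_lab p k s t U i) q_gt0) | i < s.+1.*2].

Lemma lab_word_tuple p k (q_gt0 : 0 < p ^ k.+1) s t U j :
  0 < p -> t < p - 1 -> U < p ^ (k + s) -> j < s.*2.+2 ->
  lab (word_tuple p k q_gt0 s t U) j = word_lab p k s t U j.
Proof.
move=> p_gt0 lt_t lt_U lt_j.
rewrite (lab_tnth _ _ _ _ (Ordinal lt_j)) tnth_mktuple /= modn_small //.
have q1_gt0 n : 0 < p ^ n by rewrite expn_gt0 p_gt0.
case: j {lt_j} => [|j] /=.
  have : U %/ p ^ s < p ^ k by rewrite ltn_divLR // -expnD.
  by rewrite expnSr; nia.
apply: (leq_trans (ltn_pmod _ (q1_gt0 _))); rewrite leq_pexp2l //.
by case: odd => /=; lia.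
Qed.

(** The number [u] holds the [s] free leading digits of the word; the last [k] digits are those of
    [l]. *)
Lemma word_tuple_path p k s l (t : 'I_(p - 1)) (u : 'I_(p ^ s)) :
  0 < p -> l < p ^ k -> forall q_gt0 : 0 < p ^ k.+1,
  u * p ^ k + l < p ^ (k + s) /\
  @is_path_to p k (V_ s.+1 l) (word_tuple p k q_gt0 s t (u * p ^ k + l)).
Proof.
move=> p_gt0 lt_l q_gt0; have lt_w : u * p ^ k + l < p ^ (k + s).
  by rewrite expnD; have := ltn_ord u; move: (nat_of_ord u) => v; nia.
split=> //; apply/is_path_toP => //=.
apply: eq_path_labels _ _ (word_lab_path p k s t _ p_gt0 (ltn_ord t) lt_w) => [j lt_j|].
  by rewrite lab_word_tuple.
by rewrite modnMDl modn_small.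
Qed.

Lemma sum_over_image (I J : finType) (P : pred J) (g : I -> J) (F : J -> nat) :
  injective g -> (forall i, P (g i)) -> (forall j, P j -> exists i, j = g i) ->
  \sum_(j | P j) F j = \sum_i F (g i).
Proof.
move=> g_inj Pg g_onto.
transitivity (\sum_(j in g @: [set: I]) F j).
  by apply: eq_bigl => j; apply/idP/imsetP => [/g_onto[i ->]|[i _ ->]] //; exists i.
rewrite big_imset /=; last by move=> i j _ _ /g_inj.
by apply: eq_bigl => i; rewrite inE.
Qed.

Lemma pkFib_words p k s l : 0 < p -> l < p ^ k ->
  forall q_gt0 : 0 < p ^ k.+1,
  pkFib p k (V_ s.+1 l) =
  \sum_(i : 'I_(p - 1) * 'I_(p ^ s))
     des_blocks p k (blocks (word_tuple p k q_gt0 s i.1 (i.2 * p ^ k + l))).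
Proof.
move=> p_gt0 lt_l q_gt0; rewrite /pkFib.
have lt_w (u : 'I_(p ^ s)) : u * p ^ k + l < p ^ (k + s).
  by rewrite expnD; have := ltn_ord u; move: (nat_of_ord u) => v; nia.
have qk_gt0 : 0 < p ^ k by rewrite expn_gt0 p_gt0.
apply: (sum_over_image _ _ _ (fun i : 'I_(p - 1) * 'I_(p ^ s) =>
  word_tuple p k q_gt0 s i.1 (i.2 * p ^ k + l))) => [[t u] [t' u'] /= eq_w|[t u]|x].
- have lw := lab_word_tuple p k q_gt0 s _ _ _ p_gt0 (ltn_ord _) (lt_w _).
  have w1 := word_of_lab p k s t _ _ s p_gt0 (lt_w u) (leqnn s) (lw t u).
  have w2 := word_of_lab p k s t' _ _ s p_gt0 (lt_w u') (leqnn s) (lw t' u').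
  have /eqP eq_U : u * p ^ k + l = u' * p ^ k + l.
    by move: w1; rewrite eq_w w2 subnn !divn1.
  move: eq_U; rewrite eqn_add2r eqn_pmul2r // => /eqP eq_u.
  (* Once the words agree, the label at position 0 determines [t]. *)
  have := lw t u 0 isT; rewrite eq_w lw // /word_lab eq_u => /eqP.
  rewrite eqn_add2r eqn_pmul2l // => /eqP eq_t.
  by congr (_, _); apply: val_inj.
- exact: (word_tuple_path _ _ _ _ t u p_gt0 lt_l q_gt0).2.
- move=> /is_path_toP -/(_ p_gt0) path_x.
  have [U_lt U_mod fE] := word_of_path _ _ _ _ _ p_gt0 path_x
    (fun j => lab_lt _ _ _ x j p_gt0).
  have lt_t : lab x 0 %/ p ^ k < p - 1.
    by case: path_x => f0 _ _ _; rewrite ltn_divLR // mulnC.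
  have lt_u : word_of p (lab x) s %/ p ^ k < p ^ s by rewrite ltn_divLR // mulnC -expnD.
  exists (Ordinal lt_t, Ordinal lt_u) => /=.
  rewrite -U_mod -divn_eq; apply: eq_from_tnth => j; apply: ord_inj.
  by rewrite -!lab_tnth fE // lab_word_tuple.
Qed.

(** * Counting words one window at a time *)

Lemma sum_ltn N Y : Y <= N -> \sum_(0 <= y < N) (y < Y : nat) = Y.
Proof.
move=> le_YN; rewrite (big_cat_nat (n := Y)) //=.
rewrite (eq_big_nat _ _ (F2 := fun=> 1)) ?sum_nat_const_nat; last first.
  by move=> y /andP[_ ->].
rewrite big1_seq; last by move=> y /andP[_]; rewrite mem_index_iota; lia.
by rewrite muln1 subn0 addn0.
Qed.

Lemma sum_geq N Y : Y <= N -> \sum_(0 <= y < N) (Y <= y : nat) = N - Y.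
Proof.
move=> le_YN; apply: (@addnI Y); rewrite subnKC // -{1}(sum_ltn N Y le_YN).
rewrite -big_split /= (eq_bigr (fun=> 1)) => [|y _]; last by lia.
by rewrite sum_nat_const_nat muln1 subn0.
Qed.

Lemma ltn_digits P y a Y c : a < P -> c < P ->
  (y * P + a < Y * P + c) = (y < Y + (a < c)).
Proof. by move=> lt_a lt_c; case: (ltngtP y Y); case: (ltnP a c); nia. Qed.

(** The label of [W_ i.+2] on a path whose word is [u * p ^ k + l]; it does not depend on [t]. *)
Definition window (p k s l u i : nat) : nat :=
  ((u * p ^ k + l) %/ p ^ (s - i.+1)) %% p ^ k.+1.

(** Of the [p - 1 = 2 * h] values of [t], exactly [h] give the descent at 1, for each of the [p ^ s]
    words. All other descents are independent of [t], hence are counted [2 * h] times. *)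
Lemma pkFib_windows p h k s l : p = h.*2.+1 -> 0 < h -> l < p ^ k ->
  pkFib p k (V_ s.+1 l) =
  h * (p ^ s + 2 *
    (\sum_(0 <= i < s) \sum_(0 <= u < p ^ s)
        (window p k s l u i < h * repunit p k.+1)
     + \sum_(0 <= i < s.-1) \sum_(0 <= u < p ^ s)
        ((p - 1 - window p k s l u i %/ p ^ k) * repunit p k.+1
         < window p k s l u i.+1))).
Proof.
move=> p_h h_gt0 lt_l; have p_gt0 : 0 < p by rewrite p_h.
have qk_gt0 n : 0 < p ^ n by rewrite expn_gt0 p_gt0.
rewrite (pkFib_words _ _ _ _ p_gt0 lt_l (qk_gt0 k.+1)).
pose G u := \sum_(0 <= i < s) (window p k s l u i < h * repunit p k.+1)
   + \sum_(0 <= i < s.-1) ((p - 1 - window p k s l u i %/ p ^ k) * repunit p k.+1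
         < window p k s l u i.+1).
have desE (i : 'I_(p - 1) * 'I_(p ^ s)) :
    des_blocks p k (blocks (word_tuple p k (qk_gt0 k.+1) s i.1 (i.2 * p ^ k + l)))
    = (i.1 < h) + G i.2.
  case: i => t u /=.
  have [lt_w path_w] := word_tuple_path p k s l t u p_gt0 lt_l (qk_gt0 k.+1).
  rewrite (des_path _ h _ _ l) // lab_word_tuple //= -addnA.
  congr ((_ < _) + _).
    by rewrite mulnC divnMDl // divn_small ?addn0 // ltn_divLR // -expnD.
  rewrite /G; congr (_ + _).
    apply: eq_big_nat => i lt_i; rewrite lab_word_tuple //; last by lia.
    by rewrite word_lab_W.
  apply: eq_big_nat => i lt_i; rewrite !lab_word_tuple //; try lia.
  by rewrite word_lab_W -doubleS word_lab_W.
rewrite (eq_bigr _ (fun i _ => desE i)).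
rewrite -(pair_big predT predT
  (fun (t : 'I_(p - 1)) (u : 'I_(p ^ s)) => (t < h) + G u)) /=.
have -> : \sum_(t < p - 1) \sum_(u < p ^ s) ((t < h) + G u)
    = \sum_(0 <= t < p - 1) (p ^ s * (t < h) + \sum_(0 <= u < p ^ s) G u).
  rewrite [RHS]big_mkord; apply: eq_bigr => t _.
  by rewrite big_split /= sum_nat_const card_ord big_mkord.
rewrite big_split /= -big_distrr /= sum_ltn; last by lia.
rewrite sum_nat_const_nat subn0 /G big_split /=.
rewrite exchange_big [X in _ * (_ + X)]exchange_big /=.
have -> : p - 1 = h * 2 by lia.
by ring.
Qed.

(** For [s = k + 1] the window consists of the last [k + 1 - d] digits of [u] followed by the [d]
    leading digits of [l], and [d] runs through all values from 0 to [k]. *)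
Lemma windowE p k l u d : 0 < p -> l < p ^ k -> d <= k ->
  window p k k.+1 l u d = (u %% p ^ (k.+1 - d)) * p ^ d + l %/ p ^ (k - d).
Proof.
move=> p_gt0 lt_l le_d; have q_gt0 n : 0 < p ^ n by rewrite expn_gt0 p_gt0.
have lt_ld : l %/ p ^ (k - d) < p ^ d by rewrite ltn_divLR // -expnD subnKC.
rewrite /window subSS -{1}(subnKC le_d) expnD mulnA divnMDl //.
have -> : p ^ k.+1 = p ^ (k.+1 - d) * p ^ d by rewrite -expnD subnK // ltnW.
rewrite {1}(divn_eq u (p ^ (k.+1 - d))) mulnDl -mulnA -addnA modnMDl modn_small //.
have := ltn_pmod u (q_gt0 (k.+1 - d)); move: (u %% _) => y; nia.
Qed.

Lemma windowE_lead p k l u d : 0 < p -> l < p ^ k -> d < k ->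
  window p k k.+1 l u d %/ p ^ k = u %% p ^ (k - d).+1 %/ p ^ (k - d).
Proof.
move=> p_gt0 lt_l lt_d; have q_gt0 n : 0 < p ^ n by rewrite expn_gt0 p_gt0.
rewrite windowE // ?(ltnW lt_d) // subSn ?(ltnW lt_d) //.
have -> : p ^ k = p ^ d * p ^ (k - d) by rewrite -expnD subnKC // ltnW.
rewrite divnMA divnMDl // [_ %/ _ %/ _]divn_small ?addn0 //.
by rewrite ltn_divLR // -expnD subnKC // ltnW.
Qed.

Lemma repdigit_lt p d b : 0 < p -> b < p -> b * repunit p d < p ^ d.
Proof. move=> p_gt0 lt_b; rewrite (expn_repunit _ _ p_gt0); nia. Qed.

(** The repdigit of [h] is cut at the boundary between [u] and [l] and compared lexicographically:
    the digits of [l] matter only when those of [u] tie. The [d] digits of [u] outside the window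
    are free, whence the factor [p ^ d]. *)
Lemma sum_window_lt p h k l d : p = h.*2.+1 -> l < p ^ k -> d <= k ->
  \sum_(0 <= u < p ^ k.+1) (window p k k.+1 l u d < h * repunit p k.+1) =
  p ^ d * (h * repunit p (k.+1 - d) + (l %/ p ^ (k - d) < h * repunit p d)).
Proof.
move=> p_h lt_l le_d; have p_gt0 : 0 < p by rewrite p_h.
have q_gt0 n : 0 < p ^ n by rewrite expn_gt0 p_gt0.
have lt_ld : l %/ p ^ (k - d) < p ^ d by rewrite ltn_divLR // -expnD subnKC.
have lt_hp : h < p by lia.
have le_dk : d <= k.+1 by lia.
have -> : p ^ k.+1 = p ^ d * p ^ (k.+1 - d) by rewrite -expnD subnKC.
pose F (_ y : nat) : nat :=
  y < h * repunit p (k.+1 - d) + (l %/ p ^ (k - d) < h * repunit p d).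
rewrite (eq_bigr (fun u => F (u %/ p ^ (k.+1 - d)) (u %% p ^ (k.+1 - d)))); last first.
  move=> u _; rewrite windowE // /F -(ltn_digits (p ^ d)) ?repdigit_lt //.
  by rewrite -mulnA -mulnDr -repunitD subnK.
rewrite sum_divn_modn // /F sum_nat_const_nat subn0 sum_ltn //.
have := repdigit_lt p (k.+1 - d) h p_gt0 lt_hp; case: (_ < h * _); lia.
Qed.

(** For a fixed leading digit [a] and [n = k - i], the admissible values of the [n] digits of [u] in
    the next window number [a * repunit p n], plus one if the prefix of [l] exceeds the repdigit of
    [p - 1 - a]. Summing over [a] gives [h * p * repunit p n] and, with [b = p - 1 - a], the number
    of repdigits below the prefix. *)
Lemma sum_window_gt p h k l i : p = h.*2.+1 -> l < p ^ k -> i < k ->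
  \sum_(0 <= u < p ^ k.+1)
     ((p - 1 - window p k k.+1 l u i %/ p ^ k) * repunit p k.+1
      < window p k k.+1 l u i.+1) =
  p ^ i * (h * p * repunit p (k - i)
           + \sum_(0 <= b < p) (b * repunit p i.+1 < l %/ p ^ (k - i.+1))).
Proof.
move=> p_h lt_l lt_i; have p_gt0 : 0 < p by rewrite p_h.
have q_gt0 n : 0 < p ^ n by rewrite expn_gt0 p_gt0.
set n := k - i; set ld := l %/ p ^ (k - i.+1).
have lt_ld : ld < p ^ i.+1 by rewrite ltn_divLR // -expnD subnKC.
have -> : p ^ k.+1 = p ^ i * p ^ n.+1 by rewrite -expnD; congr (_ ^ _); rewrite /n; lia.
(* Write [u = x * p ^ n.+1 + a * p ^ n + y]: [x] is free, [a] leads window [i], and [y] is the part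
   of [u] inside window [i.+1]. *)
pose F a y : nat :=
  (p - 1 - a) * repunit p n + ~~ ((p - 1 - a) * repunit p i.+1 < ld) <= y.
pose F' (_ z : nat) := F (z %/ p ^ n) (z %% p ^ n).
rewrite (eq_bigr (fun u => F' (u %/ p ^ n.+1) (u %% p ^ n.+1))); last first.
  move=> u _; rewrite windowE_lead // windowE // subSS -/n -/ld /F' /F.
  set a := _ %/ _; have -> : u %% p ^ n.+1 %% p ^ n = u %% p ^ n.
    by rewrite modn_dvdm // expnS dvdn_mull.
  have -> : repunit p k.+1 = repunit p n * p ^ i.+1 + repunit p i.+1.
    by rewrite -repunitD; congr repunit; rewrite /n; lia.
  have lt_b : p - 1 - a < p by rewrite -subnDA ltn_subrL p_gt0.
  rewrite mulnDr mulnA ltn_digits ?repdigit_lt //.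
  by case: (_ < ld) => /=; congr nat_of_bool; lia.
rewrite sum_divn_modn // /F' sum_nat_const_nat subn0; congr (_ * _).
rewrite expnS sum_divn_modn //.
have -> : \sum_(0 <= b < p) (b * repunit p i.+1 < ld) =
          \sum_(0 <= a < p) ((p - 1 - a) * repunit p i.+1 < ld).
  by rewrite big_nat_rev /=; apply: eq_big_nat => a lt_a; rewrite add0n -subnDA add1n.
have -> : h * p = \sum_(0 <= a < p) a.
  by rewrite bin2_sum bin2odd p_h /= ?odd_double // doubleK mulnC.
rewrite big_distrl /= -big_split /=; apply: eq_big_nat => a lt_a.
have e := expn_repunit p n p_gt0; have e2 : p - 1 = a + (p - 1 - a) by lia.
rewrite /F sum_geq.
  move: e; rewrite {1}e2 mulnDl => ->; case: (_ < ld) => /=; lia.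
move: e; rewrite {1}e2 mulnDl => ->; case: (_ < ld) => /=; lia.
Qed.

(** * The closed formula, with thresholds on [l] *)

(** The [k]-digit numeral made of [k - e] ones followed by [e] zeros. A comparison of the [k - e]
    leading digits of [l] with a repdigit of [b] becomes a comparison of [l] with
    [b * pow_sum p k e]. *)
Definition pow_sum (p k e : nat) : nat := \sum_(e <= j < k) p ^ j.

(** The negative terms stand on the left to avoid truncated subtraction. The identity
    [2 * (h * repunit p n) + 1 = p ^ n] collapses every constant to a power of [p]; the window
    without digits of [l], together with the descents at 1, supplies one of the [k + 1] copies of
    [2 * p ^ k.+1]. *)
Lemma pkFib_closed p h k l : p = h.*2.+1 -> 0 < h -> l < p ^ k ->
  pkFib p k (V_ (k + 2) l)
  + h * (1 + 2 * \sum_(0 <= i < k) p ^ i.+1 * (h * pow_sum p k (k - i.+1) <= l))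
  = h * (2 * (k + 1) * p ^ k.+1
         + 2 * \sum_(0 <= i < k) p ^ i *
             \sum_(0 <= b < p) (b * pow_sum p k (k - i.+1) + p ^ (k - i.+1) <= l)).
Proof.
move=> p_h h_gt0 lt_l; have p_gt0 : 0 < p by rewrite p_h.
have q_gt0 n : 0 < p ^ n by rewrite expn_gt0 p_gt0.
rewrite addn2 (pkFib_windows _ _ _ _ _ p_h h_gt0 lt_l) -mulnDr; congr (h * _) => /=.
have hrep n : 2 * (h * repunit p n) + 1 = p ^ n.
  by rewrite (expn_repunit p n p_gt0) p_h; lia.
rewrite big_nat_recl //= (sum_window_lt p h) // subn0 expn0 mul1n.
rewrite {2}/repunit big_geq // muln0 ltn0 addn0.
have e0 := hrep k.+1.
set A0 := h * repunit p k.+1 in e0 *.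
set A := \sum_(0 <= i < k) _; set B := \sum_(0 <= i < k) _.
set X := \sum_(0 <= i < k) _; set Y := \sum_(0 <= i < k) _.
(* This holds term by term: the terms of index [i] on the left add up to [p ^ k.+1] plus [p ^ i]
   times the count of repdigits. *)
suff : A + B + X = k * p ^ k.+1 + Y by rewrite -e0; lia.
have -> : k * p ^ k.+1 = \sum_(0 <= i < k) p ^ k.+1.
  by rewrite sum_nat_const_nat subn0.
rewrite /A /B /X /Y -!big_split /=; apply: eq_big_nat => i /= lt_i.
rewrite (sum_window_lt p h) // (sum_window_gt p h) // subSS.
have Te : pow_sum p k (k - i.+1) = repunit p i.+1 * p ^ (k - i.+1).
  by rewrite /pow_sum sum_pow_repunit ?leq_subr // subKn.
have -> : \sum_(0 <= b < p) (b * repunit p i.+1 < l %/ p ^ (k - i.+1)) =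
    \sum_(0 <= b < p) (b * pow_sum p k (k - i.+1) + p ^ (k - i.+1) <= l).
  apply: eq_bigr => b _; rewrite leq_divRL // Te; congr nat_of_bool.
  by rewrite mulSn mulnA addnC.
rewrite ltn_divLR // -mulnA -Te [l < _]ltnNge.
have e1 := hrep (k - i); have e2 : p ^ k.+1 = p ^ i.+1 * p ^ (k - i).
  by rewrite -expnD; congr (_ ^ _); lia.
rewrite e2 -e1 expnS; move: (\sum_(_ <= _ < _) _) => c.
by case: (_ <= l) => /=; ring.
Qed.

(** * The repdigit counts on each range of [l] *)

(** The thresholds [b * T + P] are nondecreasing in [b], so it is enough to locate [l] between two
    consecutive ones. *)
Lemma digit_count p T P l t : t <= p -> (0 < t -> (t - 1) * T + P <= l) ->
  l < t * T + P -> \sum_(0 <= b < p) (b * T + P <= l) = t.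
Proof.
move=> le_tp lo hi; rewrite -[RHS](sum_ltn p t le_tp); apply: eq_bigr => b _.
congr nat_of_bool; case: (ltnP b t) => [lt_bt|le_tb].
  have t_gt0 : 0 < t by lia.
  apply: leq_trans (lo t_gt0); rewrite leq_add2r leq_mul2r; lia.
apply/negbTE; rewrite -ltnNge; apply: leq_trans hi _.
by rewrite leq_add2r leq_mul2r le_tb orbT.
Qed.

Lemma leq_pow_sum p k e f : e <= f -> pow_sum p k f <= pow_sum p k e.
Proof.
move=> le_ef; rewrite /pow_sum; case: (leqP f k) => [le_fk|/ltnW lt_kf].
  by rewrite (big_cat_nat (n := f) le_ef le_fk) /= leq_addl.
by rewrite (big_geq lt_kf).
Qed.

Lemma exp_le_pow_sum p k e : e < k -> p ^ e <= pow_sum p k e.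
Proof. by move=> lt_ek; rewrite /pow_sum big_ltn // leq_addr. Qed.

(** In terms of digits: if a prefix of [l] exceeds the repdigit of [t], so does every longer prefix.
    Numerically, [t * repunit p (f - e) < p ^ (f - e)]. *)
Lemma leq_pow_sum_exp p k t e f : t < p -> e <= f <= k ->
  t * pow_sum p k e + p ^ e <= t * pow_sum p k f + p ^ f.
Proof.
move=> lt_tp /andP[le_ef le_fk]; have p_gt0 : 0 < p by lia.
rewrite /pow_sum (big_cat_nat (n := f) le_ef le_fk) /= sum_pow_repunit //.
have -> : p ^ f = p ^ (f - e) * p ^ e by rewrite -expnD subnK.
have := repdigit_lt p (f - e) t p_gt0 lt_tp.
move: (repunit _ _) (p ^ (f - e)) (p ^ e) (bigop _ _ _) => r P Q R lt_P.
have : (t * r).+1 * Q <= P * Q by rewrite leq_mul2r lt_P orbT.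
nia.
Qed.

(** The conclusions of this lemma and of the next two have the shape of the hypotheses of
    [pkFib_from_counts]: the first three pin down the count, the last decides whether the prefix
    reaches the repdigit of [h]. *)
Lemma counts_zero p h k i : 0 < h -> p = h.*2.+1 -> i < k ->
  [/\ 0 <= p,
     0 < 0 -> (0 - 1) * pow_sum p k (k - i.+1) + p ^ (k - i.+1) <= 0,
     0 < 0 * pow_sum p k (k - i.+1) + p ^ (k - i.+1)
   & (h * pow_sum p k (k - i.+1) <= 0) = false].
Proof.
move=> h_gt0 p_h lt_i; have p_gt0 : 0 < p by rewrite p_h.
have e_gt0 : 0 < p ^ (k - i.+1) by rewrite expn_gt0 p_gt0.
split=> //; apply/negbTE; rewrite -ltnNge muln_gt0 h_gt0.
by apply: leq_trans e_gt0 (exp_le_pow_sum _ _ _ _); lia.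
Qed.

(** The range says that the prefix of [k - i] digits exceeds the repdigit of [t - 1] while the one
    of [k - i - 1] digits does not. Every prefix is at least the repdigit of [t - 1] and below that
    of [t], so the count jumps from [t - 1] to [t] at length [k - i]. *)
Lemma counts_between p h k l i t j : p = h.*2.+1 -> i <= k - 2 -> 2 <= k ->
  1 <= t <= p - 1 ->
  (t - 1) * pow_sum p k i + p ^ i <= l ->
  l < (t - 1) * pow_sum p k i.+1 + p ^ i.+1 ->
  j < k -> let c := if j < k - i - 1 then t - 1 else t in
  [/\ c <= p,
     0 < c -> (c - 1) * pow_sum p k (k - j.+1) + p ^ (k - j.+1) <= l,
     l < c * pow_sum p k (k - j.+1) + p ^ (k - j.+1)
   & (h * pow_sum p k (k - j.+1) <= l) = (h < t)].
Proof.
move=> p_h le_i k_ge2 le_t lo hi lt_j c; rewrite {}/c.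
have lt_e : k - j.+1 < k by lia.
have PT := exp_le_pow_sum p k _ lt_e.
have hT : h < t -> h * pow_sum p k (k - j.+1) <= (t - 1) * pow_sum p k (k - j.+1).
  by move=> lt_ht; rewrite leq_mul2r; lia.
have tT : t <= h -> t * pow_sum p k (k - j.+1) <= h * pow_sum p k (k - j.+1).
  by move=> le_th; rewrite leq_mul2r; lia.
have tE T : t * T = (t - 1) * T + T by rewrite -mulSnr; congr (_ * _); lia.
case: ltnP => [lt_je|le_ej].
  have TT := leq_pow_sum p k i (k - j.+1) ltac:(lia).
  have tTT : (t - 1) * pow_sum p k (k - j.+1) <= (t - 1) * pow_sum p k i.
    by rewrite leq_mul2l TT orbT.
  (* A short prefix exceeding the repdigit of [t - 1] would force the one of [k - i - 1] digits to
     exceed it too. *)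
  have key := leq_pow_sum_exp p k (t - 1) i.+1 (k - j.+1) ltac:(lia) ltac:(lia).
  have tEe := tE (pow_sum p k (k - j.+1)).
  split; [lia| |lia|].
    move=> c_gt0; have : (t - 1 - 1) * pow_sum p k (k - j.+1) + pow_sum p k (k - j.+1) =
      (t - 1) * pow_sum p k (k - j.+1) by rewrite -mulSnr; congr (_ * _); lia.
    by lia.
  by case: (ltnP h t) => [/hT|/tT]; lia.
have TT := leq_pow_sum p k (k - j.+1) i.+1 ltac:(lia).
have tTT : t * pow_sum p k i.+1 <= t * pow_sum p k (k - j.+1).
  by rewrite leq_mul2l TT orbT.
(* The excess seen on [k - i] digits persists on longer prefixes. *)
have key := leq_pow_sum_exp p k (t - 1) (k - j.+1) i ltac:(lia) ltac:(lia).
have PTi := exp_le_pow_sum p k i.+1 ltac:(lia).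
have tEi := tE (pow_sum p k i.+1).
have e_gt0 : 0 < p ^ (k - j.+1) by rewrite expn_gt0; lia.
split; [lia|by move=> _; lia|lia|].
by case: (ltnP h t) => [/hT|/tT]; lia.
Qed.

(** Every prefix exceeds the repdigit of [t - 1], since its leading digit is [t], and is at most
    that of [t]. Equality with the latter may occur, so for [t = h] the last comparison is left
    open. *)
Lemma counts_lead p h k l t j : p = h.*2.+1 -> 1 <= t <= p - 1 ->
  t * p ^ (k - 1) <= l <= t * pow_sum p k 0 -> j < k ->
  [/\ t <= p,
     0 < t -> (t - 1) * pow_sum p k (k - j.+1) + p ^ (k - j.+1) <= l,
     l < t * pow_sum p k (k - j.+1) + p ^ (k - j.+1)
   & t != h -> (h * pow_sum p k (k - j.+1) <= l) = (h < t)].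
Proof.
move=> p_h le_t /andP[lo hi] lt_j.
have lt_e : k - j.+1 < k by lia.
have PT := exp_le_pow_sum p k _ lt_e.
have key0 := leq_pow_sum_exp p k t 0 (k - j.+1) ltac:(lia) ltac:(lia).
have key1 := leq_pow_sum_exp p k (t - 1) (k - j.+1) (k - 1) ltac:(lia) ltac:(lia).
have Tk : pow_sum p k (k - 1) = p ^ (k - 1).
  by rewrite /pow_sum -{2}(subnK (ltac:(lia) : 1 <= k)) addn1 big_nat1.
rewrite Tk -mulSnr (_ : (t - 1).+1 = t) in key1; last by lia.
split; [lia|by move=> _; lia|lia|move=> neq_th].
case: (ltnP h t) => [lt_ht|le_th].
  have : h * pow_sum p k (k - j.+1) <= (t - 1) * pow_sum p k (k - j.+1).
    by rewrite leq_mul2r; lia.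
  by lia.
have : t.+1 * pow_sum p k (k - j.+1) <= h * pow_sum p k (k - j.+1).
  by rewrite leq_mul2r; lia.
rewrite mulSn.
by lia.
Qed.

Lemma sum_expS p m n : \sum_(m <= j < n) p ^ j.+1 = \sum_(m.+1 <= j < n.+1) p ^ j.
Proof. by rewrite big_add1. Qed.

(** * Evaluation over the integers *)

Local Open Scope ring_scope.

(** Index [i] stands for the prefix of [i + 1] digits: [c i] counts the repdigits below it, and
    [g i] tells whether it reaches the repdigit of [h]. *)
Lemma pkFib_from_counts (p h k l : nat) (c : nat -> nat) (g : nat -> bool) :
  p = h.*2.+1 -> (0 < h)%N -> (l < p ^ k)%N ->
  (forall i, (i < k)%N -> [/\ (c i <= p)%N,
     (0 < c i -> (c i - 1) * pow_sum p k (k - i.+1) + p ^ (k - i.+1) <= l)%N,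
     (l < c i * pow_sum p k (k - i.+1) + p ^ (k - i.+1))%N
   & (h * pow_sum p k (k - i.+1) <= l)%N = g i]) ->
  (pkFib p k (V_ (k + 2) l))%:Z =
  h%:Z * ((2 * (k + 1) * p ^ k.+1)%:Z - 1
          + 2 * (\sum_(0 <= i < k) p ^ i * c i)%N%:Z
          - 2 * (\sum_(0 <= i < k) p ^ i.+1 * g i)%N%:Z).
Proof.
move=> p_h h_gt0 lt_l cg; have := pkFib_closed p h k l p_h h_gt0 lt_l.
have -> : (\sum_(0 <= i < k) p ^ i.+1 * (h * pow_sum p k (k - i.+1) <= l)
           = \sum_(0 <= i < k) p ^ i.+1 * g i)%N.
  by apply: eq_big_nat => i /= lt_i; have [_ _ _ ->] := cg i lt_i.
have -> : (\sum_(0 <= i < k) p ^ i * \sum_(0 <= b < p)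
             (b * pow_sum p k (k - i.+1) + p ^ (k - i.+1) <= l)
           = \sum_(0 <= i < k) p ^ i * c i)%N.
  apply: eq_big_nat => i /= lt_i; have [c1 c2 c3 _] := cg i lt_i.
  by rewrite (digit_count _ _ _ _ (c i)).
move: (pkFib _ _ _) (\sum_(_ <= _ < _) _)%N (\sum_(_ <= _ < _) _)%N.
move: (_ * p ^ _)%N => Z M X Y.
by lia.
Qed.

Theorem mainTheorem7 (p k l : nat) :
  prime p -> odd p -> (2 <= k)%N -> (l < p ^ k)%N ->
  let s := (k + 2)%N in
  let M : int := (pkFib p k (V_ s l))%:Z in
  let h : int := ((p - 1)./2)%:Z in
  let S : nat := (\sum_(0 <= j < k) p ^ j)%N in
  let C : int := (2 * (k + 1) * p ^ k.+1)%:Z - 1 in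
  (* (a) *)
  (l = 0%N -> M = h * C) /\
  (* (b) *)
  (forall i t : nat, (i <= k - 2)%N -> (1 <= t <= p - 1)%N ->
     ((t - 1) * (\sum_(i <= iota < k) p ^ iota) + p ^ i <= l)%N ->
     (l <= (t - 1) * (\sum_(i.+1 <= iota < k) p ^ iota) + p ^ i.+1 - 1)%N ->
     ((t <= (p - 1)./2)%N ->
        M = h * (C + 2 * t%:Z * S%:Z
                   - 2 * (\sum_(0 <= mu < (k - i - 1)) p ^ mu)%N%:Z)) /\
     (((p + 1)./2 <= t)%N ->
        M = h * (C + (2 * t%:Z - 2 * p%:Z) * S%:Z
                   - 2 * (\sum_(0 <= mu < (k - i - 1)) p ^ mu)%N%:Z))) /\
  (* (c) *)
  (forall t : nat, (1 <= t <= p - 1)%N -> t <> ((p - 1)./2)%N ->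
     (t * p ^ (k - 1) <= l <= t * S)%N ->
     ((t <= (p - 3)./2)%N -> M = h * (C + 2 * t%:Z * S%:Z)) /\
     (((p + 1)./2 <= t)%N -> M = h * (C + (2 * t%:Z - 2 * p%:Z) * S%:Z))) /\
  (* (d) *)
  (forall i' : nat, (1 <= i' <= k - 1)%N ->
     ((p - 1)./2 * (\sum_(i' <= iota < k) p ^ iota) <= l)%N ->
     (l <= (p - 1)./2 * (\sum_(i'.-1 <= iota < k) p ^ iota) - 1)%N ->
     M = h * (C - (p ^ k)%:Z - 2 * (\sum_(1 <= th < k) p ^ th)%N%:Z
                + 2 * (\sum_(k - i' + 1 <= mu < k.+1) p ^ mu)%N%:Z - 1)) /\
  (* (e) *)
  (l = ((p - 1)./2 * S)%N ->
     M = h * (C - (p ^ k)%:Z - 2 * (\sum_(1 <= th < k) p ^ th)%N%:Z - 1)).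
Proof.
move=> p_pr p_odd k_ge2 lt_l s M h S C.
have p_gt1 := prime_gt1 p_pr.
have [n p_n] : exists n, p = n.*2.+1.
  by exists p./2; rewrite -{1}(odd_double_half p) p_odd.
have hn : (p - 1)./2 = n by rewrite p_n subn1 /= doubleK.
have n_gt0 : (0 < n)%N by lia.
have h1 : (p + 1)./2 = n.+1 by rewrite p_n addn1 -doubleS doubleK.
rewrite /h hn h1 => {h}.
have sum_cst (c : nat) : (\sum_(0 <= i < k) p ^ i * c = c * S)%N.
  by rewrite -big_distrl mulnC.
have sum_succ (g : bool) : (\sum_(0 <= i < k) p ^ i.+1 * g = g * p * S)%N.
  rewrite -big_distrl [RHS]mulnC mulnA [RHS]mulnAC; congr (_ * _)%N.
  by rewrite mulnC big_distrr; apply: eq_bigr => i _; rewrite expnS.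
(* In the cases with leading digit [n] this turns [2 * t * S] into [p ^ k - 1]. *)
have S_n : (2 * (n * S) + 1 = p ^ k)%N.
  rewrite (expn_repunit p k) ?(ltnW p_gt1) // /repunit -/S.
  have -> : (p - 1 = 2 * n)%N by lia.
  by rewrite mulnA.
split=> [l0|].
  rewrite /M (pkFib_from_counts p n k l (fun=> 0%N) (fun=> false)) //.
    by rewrite sum_cst sum_succ /= !mul0n /C; lia.
  by move=> i lt_i; rewrite l0; apply: counts_zero.
split=> [i t le_i le_t lo hi|].
  have hi' : (l < (t - 1) * pow_sum p k i.+1 + p ^ i.+1)%N.
    by apply: leq_ltn_trans hi _; rewrite ltn_subrL addn_gt0 expn_gt0 (ltnW p_gt1) orbT.
  have := pkFib_from_counts p n k l _ _ p_n n_gt0 lt_l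
    (fun j lt_j => counts_between p n k l i t j p_n le_i k_ge2 le_t lo hi' lt_j).
  rewrite sum_succ.
  (* Compared with the constant count [t], each prefix of at most [k - i - 1] digits loses one power
     of [p]. *)
  have sum_c : (\sum_(0 <= j < k) p ^ j * (if j < k - i - 1 then t - 1 else t)
      + \sum_(0 <= mu < k - i - 1) p ^ mu = t * S)%N.
    have split_at (F : nat -> nat) : (\sum_(0 <= j < k) F j =
        \sum_(0 <= j < k - i - 1) F j + \sum_(k - i - 1 <= j < k) F j)%N.
      by apply: big_cat_nat; lia.
    rewrite mulnC /S big_distrl /= !split_at.
    rewrite addnAC -big_split /=; congr (_ + _)%N.
      by apply: eq_big_nat => j /= ->; rewrite -mulnSr; congr (_ * _)%N; lia.
    by apply: eq_big_nat => j /andP[/leq_gtF -> _].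
  rewrite /M => ->; move: sum_c; rewrite /C.
  move: (\sum_(_ <= _ < _) _)%N (\sum_(_ <= _ < _) _)%N => X Y sum_c.
  have -> : X%:Z = t%:Z * S%:Z - Y%:Z by rewrite -PoszM -sum_c; lia.
  split=> le_tn; last by rewrite le_tn mul1n PoszM; ring.
  have -> : (n < t)%N = false by lia.
  by rewrite !mul0n; ring.
split=> [t le_t neq_t le_l|].
  have lead j (lt_j : (j < k)%N) := counts_lead p n k l t j p_n le_t le_l lt_j.
  rewrite /M (pkFib_from_counts p n k l (fun=> t) (fun=> (n < t)%N)) //; last first.
    by move=> j lt_j; have [? ? ? ->] := lead j lt_j; last by apply/eqP; lia.
  rewrite sum_cst sum_succ /C; split=> le_tn.
    have -> : (n < t)%N = false by lia.
    by rewrite !mul0n PoszM; ring.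
  by rewrite le_tn mul1n !PoszM; ring.
(* Common to (d) and (e), where the leading digit is [n]: all counts equal [n], and the prefixes
   reaching the repdigit of [n] are those of at most [k - i'] digits. The value [i' = 0], with no
   upper condition, is case (e). *)
have case_h i' : (i' <= k - 1)%N -> (n * pow_sum p k i' <= l <= n * S)%N ->
    (0 < i' -> l < n * pow_sum p k i'.-1)%N ->
    M = n%:Z * (C + 2 * (n * S)%N%:Z - 2 * (\sum_(1 <= j < (k - i').+1) p ^ j)%N%:Z).
  move=> le_i /andP[lo up] hi.
  have le_n : (1 <= n <= p - 1)%N by lia.
  have le_l : (n * p ^ (k - 1) <= l <= n * pow_sum p k 0)%N.
    rewrite up andbT; apply: leq_trans lo; rewrite leq_mul2l; apply/orP; right.
    apply: leq_trans (exp_le_pow_sum _ _ _ _) (leq_pow_sum _ _ _ _ le_i); lia.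
  have lead j (lt_j : (j < k)%N) := counts_lead p n k l n j p_n le_n le_l lt_j.
  rewrite /M (pkFib_from_counts p n k l (fun=> n) (fun j => (j < k - i')%N)) //; last first.
    move=> j lt_j; have [? ? ? _] := lead j lt_j; split=> //.
    case: ltnP => [lt_ji|le_ij].
      by apply: leq_trans lo; rewrite leq_mul2l leq_pow_sum ?orbT //; lia.
    apply/negbTE; rewrite -ltnNge; apply: leq_trans (hi _) _; first by lia.
    by rewrite leq_mul2l leq_pow_sum ?orbT //; lia.
  rewrite sum_cst -sum_expS; congr (_ * (_ - 2 * _%:Z)).
  rewrite (big_cat_nat (n := (k - i')%N)) /=; try lia.
  rewrite [X in (_ + X)%N]big1_seq ?addn0.
    by apply: eq_big_nat => j /= ->; rewrite muln1.
  by move=> j /andP[_]; rewrite mem_index_iota => /andP[/leq_gtF -> _]; rewrite muln0.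
split=> [i' le_i lo hi|lE].
  rewrite (case_h i'); last 3 first.
  - by lia.
  - apply/andP; split=> //; apply: leq_trans hi _; apply: leq_trans (leq_subr _ _) _.
    by rewrite leq_mul2l (leq_pow_sum p k 0 i'.-1) ?orbT.
  (* Positivity of the threshold turns the bound ending in [- 1] into a strict inequality despite
     truncated subtraction. *)
  - move=> i'_gt0; have : (0 < n * pow_sum p k i'.-1)%N.
      rewrite muln_gt0 n_gt0; apply: leq_trans (exp_le_pow_sum _ _ _ _); last by lia.
      by rewrite expn_gt0; lia.
    by move=> nT_gt0; apply: leq_ltn_trans hi _; rewrite ltn_subrL.
  (* Both sides are the sum of [p ^ j] for [j] from 1 to [k]; this converts the sum over short
     prefixes into the form required in (d). *)
  have : (\sum_(1 <= j < (k - i').+1) p ^ j + \sum_(k - i' + 1 <= mu < k.+1) p ^ mu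
          = \sum_(1 <= th < k) p ^ th + p ^ k)%N.
    rewrite -big_nat_recr /=; last by lia.
    by rewrite addn1 -big_cat_nat //; lia.
  move: S_n {case_h}; rewrite /C.
  move: (bigop _ _ _) (bigop _ _ _) (bigop _ _ _) => X Y Z.
  by move=> e1 e2; congr (_ * _); lia.
rewrite (case_h 0%N) // ?lE ?leqnn // subn0 big_nat_recr //=; last by lia.
by congr (_ * _); rewrite /C; lia.
Qed.
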